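(* Let $u\in U$ be the solution of $b(u,v)=l(v)$ for all $v\in V$, and let $u_{\theta^k}\in U_{NN}$ be the neural network obtained at the $k$th iteration ($k\ge1$) of the sequential adaptive algorithm (described in the context) with parameters $\epsilon_0>0$ and $0<\delta<1$. If $\eta_k(u_{\theta^k})\le\eta_k(u_{\theta^{k-1}})$, where $\eta_k(w):=\|\phi(w)-\phi_k(w)\|_V$, then $$\|u-u_{\theta^k}\|_U\le\frac{2}{\alpha}\,\delta^k\epsilon_0,$$ where $\alpha>0$ is the inf-sup constant of $b$, i.e. $\sup_{0\ne v\in V}\frac{b(w,v)}{\|v\|_V}\ge\alpha\|w\|_U$ for all $w\in U$.
   Context: Setting: $U$ and $V$ are (real) Hilbert spaces with norms $\|\cdot\|_U$, $\|\cdot\|_V$; $(\cdot,\cdot)_V$ is the inner product inducing $\|\cdot\|_V$. $b:U\times V\to\mathbb{R}$ is a bilinear form and $l\in V'$ a bounded linear functional such that: (1) there is $\mu>0$ with $b(w,v)\le\mu\|w\|_U\|v\|_V$ for all $w\in U$, $v\in V$; (2) there is $\alpha>0$ with $\sup_{0\ne v\in V}\frac{b(w,v)}{\|v\|_V}\ge\alpha\|w\|_U$ for all $w\in U$; (3) if $v\in V$ satisfies $b(w,v)=0$ for all $w\in U$, then $v=0$. Under these assumptions the problem ''find $u\in U$ with $b(u,v)=l(v)$ for all $v\in V$'' has a unique solution. For $w\in U$ the residual is $r(w,\cdot):=l(\cdot)-b(w,\cdot)\in V'$. The (continuous) Riesz representative $\phi(w)\in V$ is defined by $(\phi(w),v)_V=r(w,v)$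 for all $v\in V$. $U_{NN}=\{u_\theta:\theta\in\mathbb{R}^s\}\subset U$ is the set of functions representable by a fixed neural network architecture with parameter vector $\theta$; only $U_{NN}\subset U$ is assumed. With each mesh $\mathcal{T}_k$ is associated a finite-dimensional test space $V_k\subset V$. The discrete Riesz representative $\phi_k(w)\in V_k$ is defined by $(\phi_k(w),v_k)_V=r(w,v_k)$ for all $v_k\in V_k$. The loss function is $\mathcal{L}_k(w):=\|\phi_k(w)\|_V^2$ and the Riesz discrepancy is $\eta_k(w):=\|\phi(w)-\phi_k(w)\|_V$. Sequential adaptive algorithm: given an initial mesh $\mathcal{T}_0$, $\epsilon_0>0$, $0<\delta<1$ and an initial network $u_{\theta^0}\in U_{NN}$ with $\sqrt{\mathcal{L}_0(u_{\theta^0})}\le\epsilon_0$, for $k=1,2,\dots$ set $\epsilon_k:=\delta\,\epsilon_{k-1}$ and: (ADAPT) refine $\mathcal{T}_{k-1}$ to a mesh $\mathcal{T}_k$ such that $\eta_k(u_{\theta^{k-1}})\le\epsilon_k$; (LEARN) train $u_{\theta^{k-1}}$ on $\mathcal{T}_k$ by minimizing $\mathcal{L}_k$ to obtain $u_{\theta^k}\in U_{NN}$ such that $\sqrt{\mathcal{L}_k(u_{\theta^k})}\le\epsilon_k$. *)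

(* Defs.v *)
From mathcomp Require Export all_boot all_order all_algebra.
From mathcomp Require Export all_classical all_reals all_analysis.
Export Order.TTheory GRing.Theory Num.Theory.
Export numFieldNormedType.Exports.

Set Implicit Arguments.
Unset Strict Implicit.
Unset Printing Implicit Defensive.

Local Open Scope classical_set_scope.
Local Open Scope ring_scope.

(* A real Hilbert space is rendered as a complete normed module over
   R : realType together with a positive definite symmetric bilinear form
   {dot V for idfun} that induces its norm. *)
Definition induces_norm (R : realType) (V : normedModType R)
    (ip : {dot V for idfun}) : Prop :=
  forall v : V, ip v v = `|v| ^+ 2.

Definition bounded_functional (R : realType) (V : normedModType R)
    (l : {scalar V}) : Prop :=
  exists M : R, forall v : V, `|l v| <= M * `|v|.

Definition finite_dim_subspace (R : realType) (V : lmodType R)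
    (W : set V) : Prop :=
  exists (n : nat) (e : 'I_n -> V),
    W = [set v | exists c : 'I_n -> R, v = \sum_(i < n) c i *: e i].

Definition bounded_form (R : realType) (U V : normedModType R)
    (b : {bilinear U -> V -> R | *%R & *%R}) (mu : R) : Prop :=
  forall (w : U) (v : V), b w v <= mu * `|w| * `|v|.

(* The supremum is the real-valued sup: for a bounded form the set is bounded
   above, and it is empty only if V = {0}, in which case sup set0 = 0 is the
   usual convention. *)
Definition inf_sup_condition (R : realType) (U V : normedModType R)
    (b : {bilinear U -> V -> R | *%R & *%R}) (alpha : R) : Prop :=
  forall w : U, alpha * `|w| <= sup [set b w v / `|v| | v in [set v : V | v != 0]].

Definition nondegenerate_right (R : realType) (U V : normedModType R)
    (b : {bilinear U -> V -> R | *%R & *%R}) : Prop :=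
  forall v : V, (forall w : U, b w v = 0) -> v = 0.

Definition residual (R : realType) (U V : normedModType R)
    (b : {bilinear U -> V -> R | *%R & *%R}) (l : {scalar V}) (w : U) (v : V) : R :=
  l v - b w v.

(* The p in the subspace W with (p, v)_V = f v for all v in W. It is unique when
   it exists; xget returns 0 when no such p exists, which does not happen if f
   is a bounded linear functional and W is closed. *)
Definition riesz_repr (R : realType) (V : normedModType R)
    (ip : {dot V for idfun}) (W : set V) (f : V -> R) : V :=
  xget 0 [set p | W p /\ forall v, W v -> ip p v = f v].

Section Residual_minimization.
Context (R : realType) (U V : normedModType R) (ip : {dot V for idfun}).
Context (b : {bilinear U -> V -> R | *%R & *%R}) (l : {scalar V}).

Definition phi (w : U) : V := riesz_repr ip setT (residual b l w).

Definition phi_h (Vh : set V) (w : U) : V := riesz_repr ip Vh (residual b l w).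

Definition loss (Vh : set V) (w : U) : R := `|phi_h Vh w| ^+ 2.

Definition riesz_discrepancy (Vh : set V) (w : U) : R := `|phi w - phi_h Vh w|.

Fixpoint tolerance (delta eps0 : R) (k : nat) : R :=
  if k is k'.+1 then delta * tolerance delta eps0 k' else eps0.

(* [T] and [theta] are the meshes and network parameters produced by iterations
   0, ..., n of the algorithm; their values beyond n are irrelevant. *)
Definition adaptive_run (mesh : Type) (refines : mesh -> mesh -> Prop)
    (test_space : mesh -> set V) (s : nat) (net : 'rV[R]_s -> U)
    (delta eps0 : R) (T : nat -> mesh) (theta : nat -> 'rV[R]_s)
    (n : nat) : Prop :=
  Num.sqrt (loss (test_space (T 0%N)) (net (theta 0%N))) <= eps0 /\
  forall k : nat, (1 <= k <= n)%N ->
    [/\ refines (T k) (T k.-1),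
        riesz_discrepancy (test_space (T k)) (net (theta k.-1))
          <= tolerance delta eps0 k &
        Num.sqrt (loss (test_space (T k)) (net (theta k)))
          <= tolerance delta eps0 k].

End Residual_minimization.

(* Main.v *)
(* Since b (u - w) v = r(w, v) = (phi w, v)_V, the inf-sup condition and the
   Cauchy-Schwarz inequality give alpha * `|u - w| <= `|phi w|, and
   `|phi w| <= `|phi w - phi_k w| + `|phi_k w|. For w = u_{theta^k} both terms
   are at most delta ^+ k * eps0. As phi is defined by choice, the identity
   (phi w, v)_V = r(w, v) requires the Riesz representation theorem for
   bounded functionals on a Hilbert space. *)

Require Import Defs.
From mathcomp Require Import ring lra.

Set Implicit Arguments.
Unset Strict Implicit.
Unset Printing Implicit Defensive.

Local Open Scope classical_set_scope.
Local Open Scope ring_scope.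

Section RealInnerProduct.
Context (R : realType) (V : normedModType R) (ip : {dot V for idfun}).
Context (ip_norm : induces_norm ip).

Lemma ip_sym v w : ip v w = ip w v.
Proof. by rewrite (@hermC _ false idfun _ ip) expr0 mul1r. Qed.

Lemma ip_addl v v' w : ip (v + v') w = ip v w + ip v' w.
Proof. exact: linearDl. Qed.

Lemma ip_subl v v' w : ip (v - v') w = ip v w - ip v' w.
Proof. exact: linearBl. Qed.

Lemma ip_scalel a v w : ip (a *: v) w = a * ip v w.
Proof. exact: linearZl_LR. Qed.

Lemma ip_scaler a v w : ip v (a *: w) = a * ip v w.
Proof. by rewrite ip_sym ip_scalel ip_sym. Qed.

Lemma sqr_norm_addZ t v w :
  `|v + t *: w| ^+ 2 = `|v| ^+ 2 + 2 * t * ip v w + t ^+ 2 * `|w| ^+ 2.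
Proof.
rewrite -!ip_norm ip_addl (ip_sym v) (ip_sym (t *: w)) !ip_addl.
rewrite !(ip_scalel, ip_scaler) (ip_sym w v); ring.
Qed.

(** Cauchy-Schwarz: [|v + t *: w| ^+ 2] is nonnegative at its minimizer [t = - ip v w / |w| ^+ 2],
    where it equals [|v| ^+ 2 - ip v w ^+ 2 / |w| ^+ 2]. *)
Lemma norm_ip_le v w : `|ip v w| <= `|v| * `|w|.
Proof.
have [->|w0] := eqVneq w 0.
  by rewrite -(scale0r 0) ip_scaler mul0r normr0 scale0r normr0 mulr0.
have nw : 0 < `|w| by rewrite normr_gt0.
rewrite -ler_sqr ?nnegrE ?mulr_ge0// real_normK ?num_real// exprMn.
have := sqr_ge0 `|v + (- ip v w / `|w| ^+ 2) *: w|.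
rewrite sqr_norm_addZ.
have -> : `|v| ^+ 2 + 2 * (- ip v w / `|w| ^+ 2) * ip v w
  + (- ip v w / `|w| ^+ 2) ^+ 2 * `|w| ^+ 2 = `|v| ^+ 2 - ip v w ^+ 2 / `|w| ^+ 2.
  by field; rewrite gt_eqF.
by rewrite subr_ge0 ler_pdivrMr// exprn_gt0.
Qed.

Section ApproximateRepresentative.
Context (f : V -> R) (f_lin : scalar f).
Context (M : R) (f_bounded : forall v, `|f v| <= M * `|v|).

(* A near-minimizer of the energy `|v|^2 / 2 - f v represents f up to a small
   error, by comparison with the optimal step in direction w. *)
Lemma approx_riesz_repr e : 0 < e ->
  exists v, forall w, `|ip v w - f w| <= e * `|w|.
Proof.
move=> e0.
have fZ t v w : f (v + t *: w) = f v + t * f w.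
  by rewrite addrC f_lin addrC.
pose J v := `|v| ^+ 2 / 2 - f v.
have J_lb : has_inf (range J).
  split; first by exists (J 0), 0.
  (* Completing the square in [|v| ^+ 2 / 2 - M * |v|] gives this lower bound. *)
  exists (- M ^+ 2 / 2) => _ [v _ <-]; rewrite /J.
  have := f_bounded v; rewrite ler_norml => /andP[_ fv].
  have := sqr_ge0 (`|v| - M); nra.
(* With [d = ip v w - f w], the best step along [w] lowers the energy by [d ^+ 2 / (2 * |w| ^+ 2)];
   being within [e ^+ 2 / 2] of the infimum therefore forces [|d| <= e * |w|]. *)
have e2 : 0 < e ^+ 2 / 2 by rewrite divr_gt0 ?exprn_gt0.
have [_ [v _ <-] Jv] := inf_adherent e2 J_lb.
exists v => w.
have Jmin t : J v <= J (v + t *: w) + e ^+ 2 / 2.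
  apply/ltW/(lt_le_trans Jv); rewrite lerD2r; apply: (ge_inf J_lb.2).
  by exists (v + t *: w).
have [w0|w0] := eqVneq w 0.
  have f0 : f 0 = 0.
    by apply/eqP; rewrite -normr_le0 (le_trans (f_bounded 0)) ?normr0 ?mulr0.
  by rewrite w0 f0 -(scale0r 0) ip_scaler mul0r subr0 scale0r !normr0 mulr0.
have nw : 0 < `|w| by rewrite normr_gt0.
rewrite -ler_sqr ?nnegrE ?mulr_ge0 ?(ltW e0)// real_normK ?num_real// exprMn.
(* This is the minimizer of [t * d + t ^+ 2 * |w| ^+ 2 / 2], the change of [J] from [v] to
   [v + t *: w]. *)
have := Jmin (- (ip v w - f w) / `|w| ^+ 2).
rewrite /J sqr_norm_addZ fZ => step.
rewrite -ler_pdivrMr ?exprn_gt0//.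
set d := ip v w - f w in step *.
suff : 0 <= e ^+ 2 / 2 - d ^+ 2 / `|w| ^+ 2 / 2 by lra.
rewrite [leRHS](_ : _ = `|v| ^+ 2 / 2 + (- d / `|w| ^+ 2) * ip v w
  + (- d / `|w| ^+ 2) ^+ 2 * `|w| ^+ 2 / 2 - (- d / `|w| ^+ 2) * f w
  + e ^+ 2 / 2 - `|v| ^+ 2 / 2); first by lra.
by rewrite /d; field; rewrite gt_eqF.
Qed.

End ApproximateRepresentative.

End RealInnerProduct.

(* Two approximate representatives with errors e and e' are at distance at most
   e + e', since `|v - v'|^2 = ip v (v - v') - ip v' (v - v'); so they form a
   Cauchy sequence. *)
Lemma riesz_representation (R : realType) (V : completeNormedModType R)
    (ip : {dot V for idfun}) (ip_norm : induces_norm ip)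
    (f : V -> R) (f_lin : scalar f)
    (M : R) (f_bounded : forall v, `|f v| <= M * `|v|) :
  exists p, forall v, ip p v = f v.
Proof.
have inv_gt0 n : 0 < (n.+1%:R : R)^-1 by rewrite invr_gt0 ltr0n.
have [v v_approx] := choice (fun n =>
  approx_riesz_repr ip_norm f_lin f_bounded (inv_gt0 n)).
have dist_v m n : `|v m - v n| <= m.+1%:R^-1 + n.+1%:R^-1.
  have [->|d0] := eqVneq (v m - v n) 0.
    by rewrite normr0 addr_ge0// ltW.
  rewrite -(ler_pM2r (_ : 0 < `|v m - v n|)) ?normr_gt0// -expr2 -ip_norm.
  rewrite {1}ip_subl.
  rewrite mulrDl.
  apply: le_trans (lerD (v_approx m (v m - v n)) (v_approx n (v m - v n))).
  apply: le_trans (ler_normB _ _); rewrite opprB addrA subrK.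
  exact: ler_norm.
have v_cvg : cvg (v @ \oo).
  apply/cauchy_cvgP/cauchy_exP => e e0.
  have e2 : 0 < e / 2 by rewrite divr_gt0.
  near \oo => N; exists (v N).
  suff : \forall n \near \oo, ball (v N) e (v n) by [].
  near=> n; rewrite -ball_normE /=.
  apply: le_lt_trans (dist_v N n) _; rewrite [e]splitr ltrD//.
    near: N; exact: (near_infty_natSinv_lt (PosNum e2)).
  near: n; exact: (near_infty_natSinv_lt (PosNum e2)).
exists (lim (v @ \oo)) => w; set p := lim _.
apply/eqP; rewrite -subr_eq0 -normr_le0; apply/ler_addgt0Pl => e e0.
rewrite addr0.
(* The 2 shares [e] between the distance to the limit and the error of [v n]; using [|w| + 1] covers
   [w = 0] as well. *)
have d0 : 0 < e / (2 * (`|w| + 1)) by rewrite divr_gt0// mulr_gt0// ltr_wpDl.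
near \oo => n.
have pv : `|p - v n| < e / (2 * (`|w| + 1)).
  by near: n; move/cvgrPdist_lt: v_cvg; exact.
have vn : n.+1%:R^-1 < e / (2 * (`|w| + 1)).
  by near: n; exact: (near_infty_natSinv_lt (PosNum d0)).
have -> : ip p w - f w = ip (p - v n) w + (ip (v n) w - f w).
  by rewrite ip_subl; ring.
apply: le_trans (ler_normD _ _) _.
apply: le_trans (lerD (norm_ip_le ip_norm _ _) (v_approx _ _)) _.
rewrite -mulrDl.
have le_d : `|p - v n| + n.+1%:R^-1 <= e / (`|w| + 1).
  have -> : e / (`|w| + 1) = e / (2 * (`|w| + 1)) + e / (2 * (`|w| + 1)).
    by field; rewrite gt_eqF// ltr_wpDl.
  by rewrite lerD// ltW.
apply: le_trans (ler_wpM2r _ le_d) _ => //.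
rewrite mulrAC ler_pdivrMr ?ltr_wpDl// ler_pM2l// lerDl//.
Unshelve. all: by end_near.
Qed.

Lemma residual_scalar (R : realType) (U V : normedModType R)
    (b : {bilinear U -> V -> R | *%R & *%R}) (l : {scalar V}) (w : U) :
  scalar (residual b l w).
Proof.
move=> a v v'; rewrite /residual linearP [b w _]linearPr /=; ring.
Qed.

Lemma residual_bounded (R : realType) (U V : normedModType R)
    (b : {bilinear U -> V -> R | *%R & *%R}) (l : {scalar V}) (mu : R) :
  bounded_functional l -> bounded_form b mu ->
  forall w, exists M, forall v, `|residual b l w v| <= M * `|v|.
Proof.
move=> [M lM] b_mu w; exists (M + mu * `|w|) => v.
apply: le_trans (ler_normB _ _) _; rewrite mulrDl lerD// ler_norml b_mu andbT.
(* [bounded_form] bounds [b] only from above; the lower bound comes from applying it to [- v]. *)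
by rewrite lerNl -linearNr (le_trans (b_mu _ _))// normrN.
Qed.

Lemma phiP (R : realType) (U : normedModType R) (V : completeNormedModType R)
    (ip : {dot V for idfun}) (b : {bilinear U -> V -> R | *%R & *%R})
    (l : {scalar V}) (mu : R) :
  induces_norm ip -> bounded_functional l -> bounded_form b mu ->
  forall w v, ip (phi ip b l w) v = residual b l w v.
Proof.
move=> ip_norm l_bounded b_bounded w v.
have [M rM] := residual_bounded l_bounded b_bounded w.
have [p pP] := riesz_representation ip_norm (residual_scalar b l w) rM.
rewrite /phi /riesz_repr.
(* The witness [p] excludes the default value 0 of [xget]. *)
by case: xgetP => [q _ [_ ->]//|/(_ p)[]]; split.
Qed.

Lemma error_le_norm_phi (R : realType) (U : normedModType R)
    (V : completeNormedModType R) (ip : {dot V for idfun})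
    (b : {bilinear U -> V -> R | *%R & *%R}) (l : {scalar V})
    (mu alpha : R) (u : U) :
  induces_norm ip -> bounded_functional l -> bounded_form b mu ->
  inf_sup_condition b alpha -> (forall v, b u v = l v) ->
  forall w, alpha * `|u - w| <= `|phi ip b l w|.
Proof.
move=> ip_norm l_bounded b_bounded b_inf_sup u_sol w.
apply: le_trans (b_inf_sup _) _.
set E := [set _ | _ in _].
(* [E] is empty only for trivial [V]; then its [sup] is 0 by convention. *)
have [->|/set0P E0] := eqVneq E set0; first by rewrite sup0.
apply: ge_sup E0 _ => _ [v /= v0 <-].
rewrite ler_pdivrMr ?normr_gt0// linearBl u_sol.
rewrite -/(residual b l w v) -(phiP ip_norm l_bounded b_bounded).
exact: le_trans (ler_norm _) (norm_ip_le ip_norm _ _).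
Qed.

Lemma toleranceE (R : realType) (delta eps0 : R) k :
  tolerance delta eps0 k = delta ^+ k * eps0.
Proof. by elim: k => [|k /= ->]; rewrite ?mul1r// exprS mulrA. Qed.

Theorem proposition5p2 (R : realType) (U V : completeNormedModType R)
    (ipU : {dot U for idfun}) (ipV : {dot V for idfun})
    (hU : induces_norm ipU) (hV : induces_norm ipV)
    (b : {bilinear U -> V -> R | *%R & *%R}) (l : {scalar V})
    (l_bounded : bounded_functional l)
    (mu : R) (mu_gt0 : 0 < mu) (b_bounded : bounded_form b mu)
    (alpha : R) (alpha_gt0 : 0 < alpha) (b_inf_sup : inf_sup_condition b alpha)
    (b_nondeg : nondegenerate_right b)
    (u : U) (u_sol : forall v : V, b u v = l v)
    (s : nat) (net : 'rV[R]_s -> U)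
    (mesh : Type) (refines : mesh -> mesh -> Prop)
    (test_space : mesh -> set V)
    (test_space_fin : forall t : mesh, finite_dim_subspace (test_space t))
    (eps0 : R) (eps0_gt0 : 0 < eps0)
    (delta : R) (delta_gt0 : 0 < delta) (delta_lt1 : delta < 1)
    (T : nat -> mesh) (theta : nat -> 'rV[R]_s)
    (k : nat) (k_ge1 : (1 <= k)%N)
    (run : adaptive_run ipV b l refines test_space net delta eps0 T theta k)
    (eta_le : riesz_discrepancy ipV b l (test_space (T k)) (net (theta k))
              <= riesz_discrepancy ipV b l (test_space (T k)) (net (theta k.-1))) :
  `|u - net (theta k)| <= 2 / alpha * delta ^+ k * eps0.
Proof.
have [_ /(_ k)] := run; rewrite k_ge1 leqnn => /(_ isT)[_ adapt learn].
have := error_le_norm_phi hV l_bounded b_bounded b_inf_sup u_sol (net (theta k)).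
(* ADAPT controls the discrepancy of the previous network on the current mesh; [eta_le] transfers
   this bound to the trained one. *)
have := le_trans eta_le adapt; rewrite /riesz_discrepancy.
move: learn; rewrite /loss sqrtr_sqr normr_id toleranceE.
set p := phi _ _ _ _; set ph := phi_h _ _ _ _ _ => learn discr err.
rewrite -mulrA mulrAC ler_pdivlMr// mulrC (le_trans err)//.
rewrite -[p](subrK ph) (le_trans (ler_normD _ _))//.
by rewrite mulr_natl mulr2n lerD.
Qed.
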